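(* Let $n\geq 2$ and let $\varphi\colon M^{n-1}\to\mathbb{R}^{n}$ be a complete hypersurface with mean curvature $H$, that is, an isometric immersion of a complete Riemannian manifold $M$ of dimension $n-1$ into Euclidean space. Let $r>0$ and let $B_{\mathbb{R}^2}(r)\subset\mathbb{R}^2$ be a closed disk of radius $r$. If $\varphi(M)\subset B_{\mathbb{R}^2}(r)\times\mathbb{R}^{n-2}$ and $$ \sup_M|H|<\frac{1}{(n-1)r}, $$ then $\varphi$ is not proper.
   Context: Here $\mathbb{R}^n=\mathbb{R}^2\times\mathbb{R}^{n-2}$. The mean curvature is normalized: if $\alpha$ is the second fundamental form of $\varphi$ and $\{e_1,\dots,e_{n-1}\}$ is a local orthonormal frame of $TM$, then $(n-1)|H|=\left|\sum_{i=1}^{n-1}\alpha(e_i,e_i)\right|$ (so the cylinder $\mathbb{S}^1(r)\times\mathbb{R}^{n-2}$ has mean curvature $1/((n-1)r)$). An immersion into $\mathbb{R}^n$ is proper if the preimage of every compact subset of $\mathbb{R}^n$ is compact. *)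

(* Defs.v *)
From mathcomp Require Import all_boot all_order all_algebra.
From mathcomp Require Import all_classical all_reals all_analysis.

Set Implicit Arguments.
Unset Strict Implicit.
Unset Printing Implicit Defensive.

Import Order.TTheory GRing.Theory Num.Theory.
Import numFieldNormedType.Exports.

Local Open Scope classical_set_scope.
Local Open Scope ring_scope.

(* Vectors are row vectors.  The norm `|x| of 'rV[R]_n in MathComp-Analysis is
   the sup norm (same topology), so the Euclidean one is introduced here. *)
Definition dotv (R : realType) n (u v : 'rV[R]_n) : R :=
  \sum_i u ord0 i * v ord0 i.

Definition enorm (R : realType) n (u : 'rV[R]_n) : R := Num.sqrt (dotv u u).

(* Meaningful for open U.  In finite dimension, f is C^(k+1) on U iff it is
   differentiable on U and all its directional derivatives are C^k on U. *)
Fixpoint Ck_on (R : realType) (V W : normedModType R) (k : nat) (U : set V)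
    (f : V -> W) : Prop :=
  match k with
  | 0 => forall x, U x -> {for x, continuous f}
  | k'.+1 => (forall x, U x -> differentiable f x) /\
             (forall v : V, Ck_on k' U (fun x => 'D_v f x))
  end.

Definition smooth_on (R : realType) (V W : normedModType R) (U : set V)
    (f : V -> W) : Prop := forall k, Ck_on k U f.

(* [coord] is only relevant on [dom], [param] (its inverse) only on [img]. *)
Record chart (R : realType) (T : topologicalType) (m : nat) := Chart {
  dom : set T;
  img : set 'rV[R]_m;
  coord : T -> 'rV[R]_m;
  param : 'rV[R]_m -> T;
  dom_open : open dom;
  img_open : open img;
  coord_img : forall p, dom p -> img (coord p);
  param_dom : forall x, img x -> dom (param x);
  coordK : forall p, dom p -> param (coord p) = p;
  paramK : forall x, img x -> coord (param x) = x;
  coord_cont : forall p, dom p -> {for p, continuous coord};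
  param_cont : forall x, img x -> {for x, continuous param}
}.

(* [atlas] need not be maximal; [chart_at] selects a chart around each point. *)
Record manifold (R : realType) (m : nat) := Manifold {
  carrier :> topologicalType;
  manifold_hausdorff : hausdorff_space carrier;
  manifold_second_countable : @second_countable carrier;
  atlas : set (chart R carrier m);
  chart_at : carrier -> chart R carrier m;
  chart_at_atlas : forall p, atlas (chart_at p);
  chart_at_dom : forall p, dom (chart_at p) p;
  atlas_smooth : forall c c', atlas c -> atlas c' ->
    smooth_on (img c `&` param c @^-1` dom c') (coord c' \o param c)
}.

(* [gram c p] is the Gram matrix of the metric at p in the coordinates of c:
   a tangent vector at p with c-coordinates u has squared length
   u *m gram c p *m u^T, and its c'-coordinates are u *m J, where J is the
   Jacobian of the change of coordinates. *)
Record riemannian_metric (R : realType) (m : nat) (M : manifold R m) :=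
  RiemannianMetric {
  gram :> chart R M m -> M -> 'M[R]_m;
  gram_sym : forall c p, atlas c -> dom c p -> (gram c p)^T = gram c p;
  gram_posdef : forall c p, atlas c -> dom c p ->
    forall u : 'rV[R]_m, u != 0 -> 0 < (u *m gram c p *m u^T) ord0 ord0;
  gram_smooth : forall c, atlas c -> smooth_on (img c) (gram c \o param c);
  gram_change : forall c c' p, atlas c -> atlas c' -> dom c p -> dom c' p ->
    let J := 'J (coord c' \o param c) (coord c p) in
    gram c p = J *m gram c' p *m J^T
}.

Definition C1_curve (R : realType) m (M : manifold R m) (gam : R -> M) : Prop :=
  continuous gam /\
  forall c, atlas c ->
    Ck_on 1 [set t : R^o | dom c (gam t)] (coord c \o gam : R^o -> 'rV[R]_m).

(* Norm of the velocity at t, computed in a chart around gam t. *)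
Definition speed (R : realType) m (M : manifold R m) (g : riemannian_metric M)
    (gam : R -> M) (t : R) : R :=
  let c := chart_at (gam t) in
  let v := derive1 (coord c \o gam) t in
  Num.sqrt ((v *m g c (gam t) *m v^T) ord0 ord0).

Definition curve_length (R : realType) m (M : manifold R m)
    (g : riemannian_metric M) (gam : R -> M) : \bar R :=
  (\int[@lebesgue_measure R]_(t in `[0%R, 1%R]) (speed g gam t)%:E)%E.

(* Curves are C^1 on the whole line and may have zero velocity, so that, after
   reparametrization, piecewise C^1 curves from p to q are covered.  The value
   is +oo when p and q lie in different components. *)
Definition riemannian_dist (R : realType) m (M : manifold R m)
    (g : riemannian_metric M) (p q : M) : \bar R :=
  ereal_inf [set curve_length g gam | gam in
    [set gam : R -> M | [/\ C1_curve gam, gam 0 = p & gam 1 = q]]].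

Definition complete_metric (R : realType) m (M : manifold R m)
    (g : riemannian_metric M) : Prop :=
  forall u : nat -> M,
    (forall e : R, 0 < e -> exists N : nat, forall i j : nat,
      (N <= i)%N -> (N <= j)%N -> (riemannian_dist g (u i) (u j) < e%:E)%E) ->
    exists p : M, forall e : R, 0 < e -> exists N : nat, forall i : nat,
      (N <= i)%N -> (riemannian_dist g (u i) p < e%:E)%E.

Definition smooth_map (R : realType) m n (M : manifold R m)
    (phi : M -> 'rV[R]_n) : Prop :=
  forall c, atlas c -> smooth_on (img c) (phi \o param c).

Definition isometric_immersion (R : realType) m n (M : manifold R m)
    (g : riemannian_metric M) (phi : M -> 'rV[R]_n) : Prop :=
  smooth_map phi /\
  forall c p, atlas c -> dom c p ->
    let dphi : 'rV[R]_m -> 'rV[R]_n := 'd (phi \o param c) (coord c p) in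
    injective dphi /\
    forall u v : 'rV[R]_m,
      dotv (dphi u) (dphi v) = (u *m g c p *m v^T) ord0 ord0.

(* Orthogonal projection of w onto the complement of the row space of J: the
   row space of kermx J^T consists of the vectors orthogonal to all rows of J. *)
Definition normal_part (R : realType) m n (J : 'M[R]_(m, n)) (w : 'rV[R]_n) :
    'rV[R]_n := w *m proj_mx (kermx J^T) <<J>>%MS.

(* alpha(X, Y) is the normal part of the derivative of dphi(Y) along X in R^n,
   by the Gauss formula; the tangent vectors at p with coordinates u, v are
   extended to local vector fields with constant coordinates, and the row space
   of the Jacobian is dphi(T_p M). *)
Definition second_fundamental_form (R : realType) m n (M : manifold R m)
    (phi : M -> 'rV[R]_n) (p : M) (u v : 'rV[R]_m) : 'rV[R]_n :=
  let c := chart_at p in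
  let f := phi \o param c in
  normal_part ('J f (coord c p)) ('D_u (fun x => 'D_v f x) (coord c p)).

(* The rows of e are the coordinates of the vectors of the basis. *)
Definition orthonormal_basis (R : realType) m (M : manifold R m)
    (g : riemannian_metric M) (p : M) (e : 'M[R]_m) : Prop :=
  e *m g (chart_at p) p *m e^T = 1%:M.

(* The trace of alpha does not depend on the orthonormal basis of T_p M, so
   any choice of one will do (one always exists; 0 is a dummy default). *)
Definition mean_curvature (R : realType) m n (M : manifold R m)
    (g : riemannian_metric M) (phi : M -> 'rV[R]_n) (p : M) : 'rV[R]_n :=
  let e := xget 0 [set e | orthonormal_basis g p e] in
  m%:R^-1 *: \sum_(i < m) second_fundamental_form phi p (row i e) (row i e).

Definition proper_map (R : realType) n (M : topologicalType)
    (phi : M -> 'rV[R]_n) : Prop :=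
  forall K : set 'rV[R]_n, compact K -> compact (phi @^-1` K).

Definition closed_disk (R : realType) (a : 'rV[R]_2) (r : R) : set 'rV[R]_2 :=
  [set y | enorm (y - a) <= r].

(* D x R^(n-2) in R^n = R^2 x R^(n-2), the factor R^2 being that of the first
   two coordinates. *)
Definition cylinder_over (R : realType) n (hn : (2 <= n)%N)
    (D : set 'rV[R]_2) : set 'rV[R]_n :=
  [set x | D (\row_(j < 2) x ord0 (widen_ord hn j))].

(* Main.v *)
From mathcomp Require Import all_boot all_order all_algebra.
From mathcomp Require Import all_classical all_reals all_analysis.
From mathcomp Require Import ring lra.
Require Import Defs.

Set Implicit Arguments.
Unset Strict Implicit.
Unset Printing Implicit Defensive.

Import Order.TTheory GRing.Theory Num.Theory.
Import numFieldNormedType.Exports.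
Local Open Scope classical_set_scope.
Local Open Scope ring_scope.

(** If phi were proper, a maximum principle would contradict the bound on the
    mean curvature.  Write x = (y, z) in R^2 x R^(n-2), and for e > 0 put

      F(x) = |y - a|^2 - e |z|^2.

    On the cylinder the first term is at most r^2, so the superlevel sets of F
    there are bounded, and properness makes F o phi attain its maximum at some
    point p ([proper_attains_max]).  At p half the gradient,
    w = (y - a, - e z), is normal to the hypersurface, and the second
    derivatives of F o phi in all directions are nonpositive.  Summing the
    latter over an orthonormal basis of the tangent space, and using that w
    only sees the normal part of the second derivatives of phi, gives
    ([mean_curvature_at_max])

      tr(A | T) + (n-1) <w, H> <= 0,      A = diag(1, 1, -e, ..., -e),

    which is the inequality Delta (F o phi) <= 0 at a maximum.

    The tangent space T has codimension one, so the plane R^2 x 0 contributes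
    at least 2 - 1 = 1 to the trace ([hyperplane_trace_plane]), and the trace is
    at least 1 - e n.  Comparing the value of F at p with its value at a fixed
    point p0 bounds e |z|^2 by C = r^2 + |z(phi p0)|^2 as soon as e <= 1, hence
    |w|^2 <= r^2 + e C: the weight e, small but tied to |z|^2, makes the growth
    of the gradient of |z|^2 harmless.  By Young's inequality

      - 2 r^2 (n-1) <w, H> <= |w|^2 + r^4 (n-1)^2 |H|^2
                           <= r^2 + e C + r^2 k^2,

    where k = (n-1) r sup|H| < 1.  Together these give
    r^2 (1 - k^2) <= e (2 r^2 n + C), which is false for e small enough. *)

(** * Second derivative test along a line *)

(** The derivative q of h need only be differentiable at 0, so there is no
    second order expansion to appeal to: were q'(0) > 0, q would be positive on
    some ]0, s[ because q 0 = 0, and the mean value theorem would give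
    h s > h 0. *)
Lemma local_max_second_derivative (R : realType) (h q : R -> R) (q' : R) :
  (\forall t \near (0 : R), is_derive (t : R) 1 h (q t)) ->
  is_derive (0 : R) 1 q q' ->
  (\forall t \near (0 : R), h t <= h 0) ->
  q 0 = 0 /\ q' <= 0.
Proof.
move=> dh dq hmax.
have [e /= e0 He] : exists2 e : R, 0 < e & forall t, `|t| < e ->
    is_derive (t : R) 1 h (q t) /\ h t <= h 0.
  have /nbhs_ballP[e /= e0 He] : \forall t \near (0 : R),
    is_derive (t:R) 1 h (q t) /\ h t <= h 0 by apply: filterI.
  by exists e => // t te; apply: He; rewrite -ball_normE /= sub0r normrN.
have itvE t : t \in `]- e, e[%R -> `|t| < e by rewrite in_itv /= ltr_norml.
have e0' : 0 \in `]- e, e[%R by rewrite in_itv /= e0 oppr_lt0 e0.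
have q0 : q 0 = 0.
  have d0 : is_derive (0 : R) 1 h 0.
    apply: (@derive1_at_max _ _ (- e) e) => //; first by lra.
    - by move=> t /itvE /He[[]].
    - by move=> t /itvE /He[].
  have [d0' _] := He 0 (itvE _ e0').
  by rewrite -(@derive_val _ _ _ _ _ _ _ d0') (@derive_val _ _ _ _ _ _ _ d0).
split=> //; rewrite leNgt; apply/negP => q'0.
have [dvb dvl] := dq.
(* the difference quotient of q at 0 is eventually positive *)
have /nbhs_ballP[d /= d0 Hd] : \forall t \near (0 : R)^', 0 < t^-1 * q t.
  have : (fun t : R => t^-1 *: (q (t *: 1 + 0) - q 0)) @ 0^' --> q'.
    by rewrite -dvl; exact: dvb.
  move=> /cvgr_gt /(_ 0 q'0); apply: filterS => t /=.
  by rewrite addr0 q0 subr0 [t *: 1]mulr1.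
pose s := Num.min d e / 2.
have [s0 sd se] : [/\ 0 < s, s < d & s < e].
  by rewrite /s; have [] := leP d e => *; split; lra.
have hs t : 0 <= t <= s -> is_derive t 1 h (q t).
  move=> /andP[t0 ts]; have [] // := He t.
  by rewrite ger0_norm // (le_lt_trans ts).
have [|||c cs hc] := @MVT _ h q 0 s.
- exact: s0.
- by move=> t; rewrite in_itv /= => /andP[t0 ts]; apply: hs; rewrite !ltW.
- apply: derivable_within_continuous => t; rewrite in_itv /= => ts.
  by have [] := hs _ ts.
have [] // := He s; first by rewrite ger0_norm ?ltW.
move: cs; rewrite in_itv /= => /andP[c0 cs] _.
have : 0 < c^-1 * q c.
  apply: Hd; last by rewrite gt_eqF.
  by rewrite -ball_normE /= sub0r normrN ger0_norm ?ltW // (lt_trans cs).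
rewrite pmulr_rgt0 ?invr_gt0 // => qc.
by rewrite leNgt -subr_gt0 hc subr0 mulr_gt0.
Qed.

Lemma is_derive_line (R : realType) (V W : normedModType R) (f : V -> W)
    (x v : V) (t : R) :
  derivable f (t *: v + x) v ->
  is_derive t 1 (fun s : R => f (s *: v + x)) ('D_v f (t *: v + x)).
Proof.
move=> df.
have E : (fun h : R => h^-1 *: (((fun s : R => f (s *: v + x)) \o shift t)
    (h *: (1 : R)) - f (t *: v + x))) =
  (fun h : R => h^-1 *: ((f \o shift (t *: v + x)) (h *: v) - f (t *: v + x))).
  by apply/funext => h /=; rewrite [h *: 1]mulr1 scalerDl addrA.
apply: DeriveDef; first by rewrite /derivable E.
by rewrite /derive E.
Qed.

(** The second derivative test, applied to the restriction of F to the line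
    through x directed by v. *)
Lemma local_max_directional (R : realType) (V : normedModType R)
    (F : V -> R) (x v : V) :
  (\forall y \near x, derivable F y v) -> derivable (fun y => 'D_v F y) x v ->
  (\forall y \near x, F y <= F x) ->
  'D_v F x = 0 /\ 'D_v (fun y => 'D_v F y) x <= 0.
Proof.
move=> dF ddF Fmax.
have cl : (fun t : R => t *: v + x) @ (0 : R) --> x.
  rewrite -[X in _ --> X]add0r -[X in X + _](scale0r v).
  by apply: cvgD; [apply: cvgZr_tmp; exact: cvg_id | exact: cvg_cst].
have E0 : 0 *: v + x = x by rewrite scale0r add0r.
have := @local_max_second_derivative _ (fun s : R => F (s *: v + x))
  (fun s : R => 'D_v F (s *: v + x)) ('D_v (fun y => 'D_v F y) x).
rewrite E0; apply.
- have : \forall t \near (0 : R), derivable F (t *: v + x) v.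
    exact: (cl _ dF).
  by apply: filterS => t; exact: is_derive_line.
- rewrite -[X in is_derive _ _ _ ('D_v _ X)]E0.
  by apply: is_derive_line; rewrite E0.
- exact: (cl _ Fmax).
Qed.

(** * Euclidean linear algebra *)

Lemma dotvE (R : realType) n (u v : 'rV[R]_n) : dotv u v = (u *m v^T) ord0 ord0.
Proof. by rewrite /dotv mxE; apply: eq_bigr => k _; rewrite mxE. Qed.

Lemma mulmx_tr_dotv (R : realType) m1 m2 n (A : 'M[R]_(m1, n))
    (B : 'M[R]_(m2, n)) i j : (A *m B^T) i j = dotv (row i A) (row j B).
Proof. by rewrite mxE; apply: eq_bigr => k _; rewrite !mxE. Qed.

Lemma dotvv_eq0 (R : realType) n (u : 'rV[R]_n) : dotv u u = 0 -> u = 0.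
Proof.
move=> u0; apply/rowP => k; rewrite mxE.
have /(_ k isT)/eqP := psumr_eq0P (fun i _ => sqr_ge0 (u ord0 i)) u0.
by rewrite sqrf_eq0 => /eqP.
Qed.

(** Gram-Schmidt: as long as the k < m rows of e are orthonormal for G, the
    kernel of G *m e^T holds a nonzero vector, G-orthogonal to these rows, and
    it can be normalized because G is positive definite. *)
Lemma posdef_orthonormal_basis (R : rcfType) m (G : 'M[R]_m) :
  G^T = G ->
  (forall u : 'rV[R]_m, u != 0 -> 0 < (u *m G *m u^T) ord0 ord0) ->
  exists e : 'M[R]_m, e *m G *m e^T = 1%:M.
Proof.
move=> Gsym Gpos.
suff H k : (k <= m)%N -> exists e : 'M[R]_(k, m), e *m G *m e^T = 1%:M.
  exact: H.
elim: k => [_|k IH km].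
  by exists 0; rewrite [LHS]flatmx0 [RHS]flatmx0.
have [e He] := IH (ltnW km).
have /rowV0Pn[u /sub_kermxP ue u0] : kermx (G *m e^T) != 0.
  rewrite kermx_eq0 /row_free; apply: contraTneq km => rk.
  by rewrite -leqNgt -rk rank_leq_col.
have a0 := Gpos u u0.
pose s := Num.sqrt ((u *m G *m u^T) ord0 ord0).
have s0 : s != 0 by rewrite sqrtr_eq0 -ltNge.
have ss : s * s = (u *m G *m u^T) ord0 ord0 by rewrite -expr2 sqr_sqrtr ?ltW.
rewrite -[k.+1]/(1 + k)%N; exists (col_mx (s^-1 *: u) e).
rewrite tr_col_mx mul_col_mx mul_col_row He.
have -> : (s^-1 *: u) *m G *m (s^-1 *: u)^T = 1%:M.
  rewrite linearZ /= -!scalemxAl -scalemxAr (mx11_scalar (u *m G *m u^T)) -ss.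
  by rewrite !scale_scalar_mx; congr _%:M; field.
have ue' : (s^-1 *: u) *m G *m e^T = 0.
  by rewrite -!scalemxAl -mulmxA ue scaler0.
have -> : e *m G *m (s^-1 *: u)^T = 0.
  by apply: trmx_inj; rewrite !trmx_mul trmxK Gsym mulmxA ue' trmx0.
by rewrite ue' -scalar_mx_block.
Qed.

(** A normal vector does not see tangential components.  What has to be checked
    is that the kernel of J^T is a complement of the row space of J, so that the
    projection defining [normal_part] really splits x; this holds since a vector
    of both spaces is orthogonal to itself. *)
Lemma dot_normal_part (R : realType) m n (J : 'M[R]_(m, n)) (w x : 'rV[R]_n) :
  w *m J^T = 0 -> dotv w (normal_part J x) = dotv w x.
Proof.
move=> wJ; set K := kermx J^T.
have KJ0 : (K :&: <<J>> = 0)%MS.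
  apply/eqP; rewrite -submx0; apply/rV_subP => u.
  rewrite sub_capmx genmxE => /andP[/sub_kermxP uK /submxP[a ua]].
  suff -> : u = 0 by rewrite sub0mx.
  apply: dotvv_eq0; rewrite dotvE {2}ua trmx_mul mulmxA uK mul0mx mxE //.
have KJ1 : (x <= K + <<J>>)%MS.
  apply: submx_full; rewrite /row_full mxrank_disjoint_sum // genmxE.
  by rewrite mxrank_ker mxrank_tr subnK // rank_leq_col.
have wJx : dotv w (x *m proj_mx <<J>>%MS K) = 0.
  have : (x *m proj_mx <<J>>%MS K <= J)%MS by rewrite -(genmxE J) proj_mx_sub.
  by move=> /submxP[a ->]; rewrite dotvE trmx_mul mulmxA wJ mul0mx mxE.
rewrite -[in RHS](add_proj_mx KJ0 KJ1) [RHS]dotvE linearD mulmxDr mxE -!dotvE.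
by rewrite wJx addr0.
Qed.

(** The sum is the diagonal entry P_kk of the orthogonal projection
    P = E^T *m E, and P = P *m P^T yields P_kk >= P_kk ^ 2. *)
Lemma orthonormal_rows_col_le1 (R : realDomainType) m n (E : 'M[R]_(m, n)) k :
  E *m E^T = 1%:M -> \sum_i E i k ^+ 2 <= 1.
Proof.
move=> EE; pose P := E^T *m E.
have PE : P k k = \sum_i E i k ^+ 2.
  by rewrite mxE; apply: eq_bigr => i _; rewrite mxE.
have PP : P *m P^T = P.
  by rewrite trmx_mul trmxK mulmxA -(mulmxA E^T) EE mulmx1.
have : P k k ^+ 2 <= (P *m P^T) k k.
  rewrite [(P *m P^T) k k]mxE (bigD1 k) //= [P^T k k]mxE expr2 lerDl.
  by apply: sumr_ge0 => j _; rewrite [P^T j k]mxE -expr2 sqr_ge0.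
by rewrite PP PE; nra.
Qed.

Lemma orthonormal_rows_sum (R : comNzRingType) m n (E : 'M[R]_(m, n)) :
  E *m E^T = 1%:M -> \sum_k \sum_i E i k ^+ 2 = m%:R.
Proof.
move=> EE; rewrite exchange_big /= -[m in RHS]card_ord -sumr_const.
apply: eq_bigr => i _; have : (E *m E^T) i i = 1 by rewrite EE mxE eqxx.
by rewrite mxE => <-; apply: eq_bigr => k _; rewrite mxE.
Qed.

(** The n numbers 1 - c_k, where c_k is the squared length of the projection of
    the k-th coordinate vector onto the row space of E, are nonnegative with
    sum n - (n-1) = 1.  The first two of them add up to at most 1, that is
    2 - (c_0 + c_1) <= 1. *)
Lemma hyperplane_trace_plane (R : realDomainType) n (hn : (2 <= n)%N)
    (E : 'M[R]_(n.-1, n)) :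
  E *m E^T = 1%:M -> 1 <= \sum_(k < n | (k < 2)%N) \sum_i E i k ^+ 2.
Proof.
move=> EE; pose c k := \sum_i E i k ^+ 2.
have c1 k : 0 <= 1 - c k by rewrite subr_ge0 orthonormal_rows_col_le1.
have ctot : \sum_k (1 - c k) = 1.
  rewrite sumrB orthonormal_rows_sum // sumr_const card_ord.
  by rewrite -[in n%:R](ltn_predK hn) -natr1 addrAC subrr add0r.
have c2 : \sum_(k < n | (k < 2)%N) (1 - c k) = 2 - \sum_(k < n | (k < 2)%N) c k.
  rewrite sumrB; congr (_ - _).
  by rewrite (big_ord_narrow hn) sumr_const card_ord.
have : 0 <= \sum_(k < n | ~~ (k < 2)%N) (1 - c k) by apply: sumr_ge0.
move: ctot; rewrite (bigID (fun k : 'I_n => (k < 2)%N)) /= c2 -/c.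
by move: (\sum_(k < n | ~~ _) _) => t; lra.
Qed.

Lemma rV_norm_le (R : realType) n (v : 'rV[R]_n) (B : R) :
  0 <= B -> (forall k, `|v ord0 k| <= B) -> `|v| <= B.
Proof.
move=> B0 vB; rewrite /Num.Def.normr /= mx_normrE bigmax_le // => -[i k] _ /=.
by rewrite ord1.
Qed.

(** Young's inequality, multiplied out: the right-hand side is the squared
    length of w + s *: h. *)
Lemma dotv_young (R : realType) n (w h : 'rV[R]_n) (s : R) :
  0 <= dotv w w + 2 * s * dotv w h + s ^+ 2 * dotv h h.
Proof.
have -> : dotv w w + 2 * s * dotv w h + s ^+ 2 * dotv h h =
    \sum_k (w ord0 k + s * h ord0 k) ^+ 2.
  rewrite /dotv !mulr_sumr -!big_split; apply: eq_bigr => k _ /=.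
  by ring.
by apply: sumr_ge0 => k _; exact: sqr_ge0.
Qed.

Lemma dotvv_enorm (R : realType) n (u : 'rV[R]_n) : dotv u u = enorm u ^+ 2.
Proof.
by rewrite sqr_sqrtr // /dotv; apply: sumr_ge0 => k _; rewrite -expr2 sqr_ge0.
Qed.

Lemma enorm_ge0 (R : realType) n (u : 'rV[R]_n) : 0 <= enorm u.
Proof. exact: sqrtr_ge0. Qed.

(** * Weighted square distances *)

(** Weights of both signs are allowed. *)
Definition weighted_sqdist (R : realType) n (d : 'I_n -> R)
    (b x : 'rV[R]_n) : R :=
  \sum_k d k * (x ord0 k - b ord0 k) ^+ 2.

Lemma weighted_sqdist_continuous (R : realType) n (d : 'I_n -> R)
    (b : 'rV[R]_n) : continuous (weighted_sqdist d b).
Proof.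
apply: continuous_big => [|k _ x]; first exact: add_continuous.
have yk : (fun y : 'rV[R]_n => y ord0 k - b ord0 k) @ x -->
    x ord0 k - b ord0 k.
  exact: (cvgB (@coord_continuous _ _ _ ord0 k x) (cvg_cst _)).
exact: (cvgM (cvg_cst _) (cvgM yk yk)).
Qed.

Lemma is_derive_coord (R : realType) (V : normedModType R) n
    (f : V -> 'rV[R]_n) (x v : V) k : derivable f x v ->
  is_derive x v (fun y => f y ord0 k) ('D_v f x ord0 k).
Proof.
move=> df; rewrite (derive_mx df) mxE; apply: derivableP.
exact: (derivable_mxP _ _ _).1.
Qed.

Lemma is_derive_weighted_sqdist (R : realType) (V : normedModType R) n
    (d : 'I_n -> R) (b : 'rV[R]_n) (f : V -> 'rV[R]_n) (x v : V) :
  derivable f x v ->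
  is_derive x v (fun y => weighted_sqdist d b (f y))
    (2 * \sum_k d k * (f x ord0 k - b ord0 k) * 'D_v f x ord0 k).
Proof.
move=> df.
have -> : (fun y => weighted_sqdist d b (f y)) =
    \sum_k d k *: ((fun y => f y ord0 k) - cst (b ord0 k)) ^+ 2.
  by apply/funext => y; rewrite fct_sumE.
rewrite mulr_sumr; apply: is_derive_sum => k.
have dfk := is_derive_coord k df.
apply: is_derive_eq; rewrite /= expr1 subr0 /GRing.scale /=.
by rewrite !fctE; ring.
Qed.

(** With h the derivative of f, this differentiates the derivative found in
    [is_derive_weighted_sqdist]. *)
Lemma is_derive_weighted_dot (R : realType) (V : normedModType R) n
    (d : 'I_n -> R) (b : 'rV[R]_n) (f h : V -> 'rV[R]_n) (x v : V) :
  derivable f x v -> derivable h x v ->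
  is_derive x v
    (fun y => 2 * \sum_k d k * (f y ord0 k - b ord0 k) * h y ord0 k)
    (2 * \sum_k d k * ('D_v f x ord0 k * h x ord0 k
                       + (f x ord0 k - b ord0 k) * 'D_v h x ord0 k)).
Proof.
move=> df dh.
have -> : (fun y => 2 * \sum_k d k * (f y ord0 k - b ord0 k) * h y ord0 k) =
    \sum_k (2 * d k) *: (((fun y => f y ord0 k) - cst (b ord0 k))
                         * (fun y => h y ord0 k)).
  apply/funext => y; rewrite fct_sumE mulr_sumr; apply: eq_bigr => k _.
  by rewrite !fctE /GRing.scale /= !mulrA.
rewrite mulr_sumr; apply: is_derive_sum => k.
have dfk := is_derive_coord k df.
have dhk := is_derive_coord k dh.
apply: is_derive_eq; rewrite /= subr0 /GRing.scale /=.
by rewrite !fctE; ring.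
Qed.

(** First and second order conditions for F o f at a maximum, F being the
    weighted square distance and w half its gradient: the second derivative of
    F o f / 2 is the Hessian of F / 2 on 'D_v f plus w paired with the second
    derivative of f. *)
Lemma weighted_sqdist_local_max (R : realType) (V : normedModType R) n
    (d : 'I_n -> R) (b : 'rV[R]_n) (f : V -> 'rV[R]_n) (U : set V) (x : V) :
  open U -> U x -> Ck_on 2 U f ->
  (forall y, U y -> weighted_sqdist d b (f y) <= weighted_sqdist d b (f x)) ->
  let w := \row_k (d k * (f x ord0 k - b ord0 k)) in
  forall v, dotv w ('D_v f x) = 0 /\
    \sum_k d k * 'D_v f x ord0 k ^+ 2
      + dotv w ('D_v (fun y => 'D_v f y) x) <= 0.
Proof.
move=> Uo Ux [fd ddf] fmax w v.
have df2 : derivable (fun y => 'D_v f y) x v.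
  by apply: diff_derivable; exact: (ddf v).1.
have df y : U y -> derivable f y v by move=> Uy; exact/diff_derivable/fd.
have dF y (Uy : U y) := is_derive_weighted_sqdist d b (df y Uy).
have ddF := is_derive_weighted_dot d b (df x Ux) df2.
have nU : \forall y \near x, U y by exact: open_nbhs_nbhs.
have eqD : \forall y \near x,
    2 * (\sum_k d k * (f y ord0 k - b ord0 k) * 'D_v f y ord0 k) =
    'D_v (fun y => weighted_sqdist d b (f y)) y.
  by apply: filterS nU => y Uy; rewrite (@derive_val _ _ _ _ _ _ _ (dF y Uy)).
have ddF' := near_eq_is_derive eqD ddF.
have [|||D0 D2] := @local_max_directional _ _
  (fun y => weighted_sqdist d b (f y)) x v.
- by apply: filterS nU => y /dF[].
- by have [] := ddF'.
- by apply: filterS nU => y; exact: fmax.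
move: D0 D2; rewrite (@derive_val _ _ _ _ _ _ _ (dF x Ux)).
rewrite (@derive_val _ _ _ _ _ _ _ ddF').
have -> : \sum_k d k * (f x ord0 k - b ord0 k) * 'D_v f x ord0 k =
    dotv w ('D_v f x).
  by apply: eq_bigr => k _; rewrite mxE.
move=> /eqP; rewrite mulf_eq0 pnatr_eq0 /= => /eqP w0.
rewrite pmulr_rle0 // => D2.
split=> //; apply: le_trans D2; rewrite -big_split le_eqVlt; apply/orP; left.
by apply/eqP/eq_bigr => k _; rewrite mxE /=; ring.
Qed.

Lemma weighted_sum_split (R : realDomainType) n (e : R) (G : 'I_n -> R) :
  \sum_(k < n) (if (k < 2)%N then 1 else - e) * G k =
  \sum_(k < n | (k < 2)%N) G k - e * \sum_(k < n | ~~ (k < 2)%N) G k.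
Proof.
rewrite (bigID (fun k : 'I_n => (k < 2)%N)) /= -mulNr mulr_sumr.
congr (_ + _); apply: eq_bigr => k; first by move=> ->; rewrite mul1r.
by move=> /negbTE ->.
Qed.

(** * Maxima on a properly immersed manifold *)

Lemma smooth_map_continuous (R : realType) m n (M : manifold R m)
    (phi : M -> 'rV[R]_n) : smooth_map phi -> continuous phi.
Proof.
move=> phiS p; set c := chart_at p.
have pc : dom c p := chart_at_dom p.
have := phiS c (chart_at_atlas p) 0%N (coord c p) (coord_img pc).
move=> /(continuous_comp (coord_cont pc)) H.
have E : {near p, (phi \o param c) \o coord c =1 phi}.
  have : \forall q \near p, dom c q.
    by apply: open_nbhs_nbhs; split=> //; exact: dom_open.
  by apply: filterS => q qc /=; rewrite coordK.
have := cvg_trans (near_eq_cvg E) H.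
have -> : ((phi \o param c) \o coord c) p = phi p by rewrite /= coordK.
exact.
Qed.

(** The points phi q with F (phi q) >= F (phi p0) lie in a closed ball K, whose
    preimage is compact because phi is proper; a maximum over that preimage is a
    global one. *)
Lemma proper_attains_max (R : realType) (M : topologicalType) n
    (phi : M -> 'rV[R]_n) (F : 'rV[R]_n -> R) (p0 : M) (b : 'rV[R]_n) (B : R) :
  proper_map phi -> continuous phi -> continuous F ->
  (forall q, F (phi p0) <= F (phi q) -> `|phi q - b| <= B) ->
  exists p, forall q, F (phi q) <= F (phi p).
Proof.
move=> phiP phic Fc bounded.
pose K : set 'rV[R]_n := closed_ball_ Num.norm b B.
have KE x : K x = (`|x - b| <= B) by rewrite /K /closed_ball_ /= distrC.
have Kc : compact K.
  apply: bounded_closed_compact; last exact: closed_closed_ball_.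
  exists (B + `|b|); split; first exact: num_real.
  move=> t Bt x; rewrite /= KE => xB; apply: le_trans (ltW Bt).
  by rewrite -[x in leLHS](subrK b) (le_trans (ler_normD _ _)) // lerD2r.
have K0 : (phi @^-1` K) !=set0 by exists p0; rewrite /= KE; exact: bounded.
have [p _ pmax] := compact_EVT_max K0 (phiP K Kc)
  (continuous_subspaceT (fun q => continuous_comp (phic q) (Fc (phi q)))).
exists p => q; have [Kq|Kq] := pselect (K (phi q)).
  by apply: (pmax q); rewrite inE.
have p0p : F (phi p0) <= F (phi p).
  by apply: (pmax p0); rewrite inE /= KE; exact: bounded.
apply: le_trans p0p; rewrite leNgt; apply/negP => /ltW /bounded.
by rewrite -KE.
Qed.

(** The maximum principle.  The rows of E form an orthonormal basis of the
    tangent space of phi at p, pushed forward from the basis e chosen in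
    [mean_curvature].  The first order condition makes w, half the gradient of
    the weighted square distance, normal at p, so that pairing w with the second
    derivative of phi or with the second fundamental form gives the same number;
    summing the second order conditions along the basis then turns these into
    <w, m H>. *)
Lemma mean_curvature_at_max (R : realType) m n (M : manifold R m)
    (g : riemannian_metric M) (phi : M -> 'rV[R]_n) (d : 'I_n -> R)
    (b : 'rV[R]_n) (p : M) :
  (0 < m)%N -> isometric_immersion g phi ->
  (forall q, weighted_sqdist d b (phi q) <= weighted_sqdist d b (phi p)) ->
  exists2 E : 'M[R]_(m, n), E *m E^T = 1%:M &
    \sum_k d k * (\sum_i E i k ^+ 2) +
    dotv (\row_k (d k * (phi p ord0 k - b ord0 k)))
         (m%:R *: mean_curvature g phi p) <= 0.
Proof.
move=> m0 [phiS phiI] pmax; set c := chart_at p.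
have cA : atlas c := chart_at_atlas p.
have pc : dom c p := chart_at_dom p.
have xc := coord_img pc; set x := coord c p in xc *.
pose f := phi \o param c.
have fx : f x = phi p by rewrite /f /= coordK.
have fS : Ck_on 2 (img c) f := phiS c cA 2%N.
have df : differentiable f x := fS.1 x xc.
have [_ dphi] := phiI c p cA pc.
have fmax y : img c y ->
    weighted_sqdist d b (f y) <= weighted_sqdist d b (f x).
  by move=> _; rewrite fx; exact: pmax.
have crit := weighted_sqdist_local_max (@img_open _ _ _ c) xc fS fmax.
move: crit; cbv zeta; rewrite fx; set w := \row_k _ => crit.
rewrite /mean_curvature; set e := xget _ _.
have ebasis : e *m g c p *m e^T = 1%:M.
  have [e0 He0] := posdef_orthonormal_basis (gram_sym g cA pc)
    (gram_posdef g cA pc).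
  exact: (@xgetI _ _ [set e | orthonormal_basis g p e] e0 He0).
pose J := 'J f x.
have wJ : w *m J^T = 0.
  apply/rowP => i; have [D0 _] := crit (delta_mx ord0 i).
  move: D0; rewrite deriveEjacobian // dotvE trmx_mul mulmxA.
  by rewrite trmx_delta -colE !mxE => ->.
have EE : (e *m J) *m (e *m J)^T = 1%:M.
  rewrite -ebasis; apply/matrixP => i j.
  rewrite !mulmx_tr_dotv !row_mul -!deriveEjacobian // !deriveE // dphi.
  by rewrite -dotvE.
exists (e *m J) => //.
rewrite scalerA mulfV ?pnatr_eq0 -?lt0n // scale1r.
have -> : dotv w (\sum_i second_fundamental_form phi p (row i e) (row i e)) =
    \sum_i dotv w ('D_(row i e) (fun y => 'D_(row i e) f y) x).
  rewrite dotvE linear_sum mulmx_sumr summxE; apply: eq_bigr => i _.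
  by rewrite -dotvE dot_normal_part.
have -> : \sum_k d k * (\sum_i (e *m J) i k ^+ 2) =
    \sum_i \sum_k d k * 'D_(row i e) f x ord0 k ^+ 2.
  rewrite exchange_big; apply: eq_bigr => k _; rewrite mulr_sumr.
  by apply: eq_bigr => i _; rewrite deriveEjacobian // -row_mul [in RHS]mxE.
rewrite -big_split; apply: sumr_le0 => i _.
by have [_] := crit (row i e).
Qed.

(** * The cylinder theorem *)

Theorem corollary2p2 (R : realType) (n : nat) (hn : (2 <= n)%N)
    (M : manifold R n.-1) (g : riemannian_metric M)
    (hM0 : [set: M] !=set0)
    (hcomplete : complete_metric g)
    (phi : M -> 'rV[R]_n) (hphi : isometric_immersion g phi)
    (r : R) (hr : 0 < r) (a : 'rV[R]_2)
    (hcyl : phi @` [set: M] `<=` cylinder_over hn (closed_disk a r))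
    (hH : (ereal_sup [set (enorm (mean_curvature g phi p))%:E | p in [set: M]]
           < (1 / (n.-1%:R * r))%:E)%E) :
  ~ proper_map phi.
Proof.
move=> phiP; have [p0 _] := hM0.
have m0 : (0 < n.-1)%N by rewrite -ltnS (ltn_predK hn).
have m0' : (0 : R) < n.-1%:R by rewrite ltr0n.
(* passing from the extended supremum to a real bound; it is not -oo because M
   has a point *)
have [K HK Km] : exists2 K : R,
    forall p, enorm (mean_curvature g phi p) <= K & n.-1%:R * r * K < 1.
  have ub p : ((enorm (mean_curvature g phi p))%:E <=
    ereal_sup [set (enorm (mean_curvature g phi p))%:E | p in [set: M]])%E.
    by apply: ereal_sup_ubound; exists p.
  case: ereal_sup hH ub => [K||] // KH ub.
    exists K => [p|]; first by have := ub p; rewrite lee_fin.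
    by move: KH; rewrite lte_fin ltr_pdivlMr ?mulr_gt0 // mulrC.
  by have := ub p0.
have K0 : 0 <= K := le_trans (enorm_ge0 _) (HK p0).
pose b : 'rV[R]_n := \row_k if (k < 2)%N then a ord0 (inord k) else 0.
pose Q1 (x : 'rV[R]_n) := \sum_(k < n | (k < 2)%N) (x ord0 k - b ord0 k) ^+ 2.
pose Q2 (x : 'rV[R]_n) :=
  \sum_(k < n | ~~ (k < 2)%N) (x ord0 k - b ord0 k) ^+ 2.
have Q1_ge0 x : 0 <= Q1 x by apply: sumr_ge0 => k _; exact: sqr_ge0.
have Q2_ge0 x : 0 <= Q2 x by apply: sumr_ge0 => k _; exact: sqr_ge0.
have Q1r q : Q1 (phi q) <= r ^+ 2.
  have : cylinder_over hn (closed_disk a r) (phi q) by apply: hcyl; exists q.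
  rewrite /cylinder_over /closed_disk /= => qr.
  rewrite /Q1 (big_ord_narrow hn).
  have := lerXn2r 2 (enorm_ge0 _) (ltW hr) qr.
  rewrite -dotvv_enorm; apply: le_trans; rewrite le_eqVlt; apply/orP; left.
  apply/eqP/eq_bigr => j _; rewrite !mxE /= ltn_ord expr2.
  by rewrite inord_val.
pose C := r ^+ 2 + Q2 (phi p0).
pose D := 2 * r ^+ 2 * n%:R + C.
pose kappa := n.-1%:R * r * K.
have kappa0 : 0 <= kappa by rewrite !mulr_ge0 // ltW.
have C0 : 0 <= C by rewrite addr_ge0 // sqr_ge0.
have D0 : 0 <= D by have := mulr_ge0 (sqr_ge0 r) (ler0n R n); rewrite /D; lra.
(* e is chosen before the maximum point p, which depends on it *)
have [e [e0 e1 eD]] :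
    exists e, [/\ 0 < e, e <= 1 & e * D < r ^+ 2 * (1 - kappa ^+ 2)].
  pose dl := r ^+ 2 * (1 - kappa ^+ 2).
  have dl0 : 0 < dl by rewrite mulr_gt0 ?exprn_gt0 // subr_gt0 expr_lt1.
  have D1 : 0 < D + 1 by lra.
  exists (Num.min 1 (dl / (D + 1))).
  have q0 : 0 < dl / (D + 1) by rewrite divr_gt0.
  have qE : dl / (D + 1) * (D + 1) = dl by rewrite divfK // gt_eqF.
  rewrite -/dl; have [] := leP 1 (dl / (D + 1)) => h; split=> //; nra.
pose d (k : 'I_n) := if (k < 2)%N then 1 else - e.
have FE x : weighted_sqdist d b x = Q1 x - e * Q2 x.
  exact: weighted_sum_split.
have Q2C q : weighted_sqdist d b (phi p0) <= weighted_sqdist d b (phi q) ->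
    e * Q2 (phi q) <= C.
  rewrite !FE /C => pq; have := Q1r q; have := Q1_ge0 (phi p0).
  by have := Q2_ge0 (phi p0); nra.
have [p pmax] : exists p, forall q,
    weighted_sqdist d b (phi q) <= weighted_sqdist d b (phi p).
  (* a coordinate t of phi q - b has t^2 <= r^2 + C / e, and |t| <= 1 + t^2 *)
  apply: (@proper_attains_max _ _ _ _ _ p0 b (1 + (r ^+ 2 + C / e))) => //.
  - exact: smooth_map_continuous hphi.1.
  - exact: weighted_sqdist_continuous.
  move=> q /Q2C qC.
  have Q2q : Q2 (phi q) <= C / e by rewrite ler_pdivlMr // mulrC.
  have := Q1r q; have := Q1_ge0 (phi q); have := Q2_ge0 (phi q).
  move=> Q2q0 Q1q0 Q1q.
  apply: rV_norm_le => [|k]; first lra.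
  have kQ : (phi q ord0 k - b ord0 k) ^+ 2 <= Q1 (phi q) + Q2 (phi q).
    rewrite /Q1 /Q2 -(bigID (fun k : 'I_n => (k < 2)%N) predT) /= (bigD1 k) //=.
    by rewrite lerDl; apply: sumr_ge0 => *; exact: sqr_ge0.
  rewrite !mxE ler_norml; move: kQ; rewrite !mxE.
  by set t := _ - _ => kQ; apply/andP; split; nra.
have [E EE] := mean_curvature_at_max m0 hphi pmax.
set w := \row_k _; set h := _ *: _.
rewrite weighted_sum_split.
have S1 := hyperplane_trace_plane hn EE.
have S2 : \sum_(k < n | ~~ (k < 2)%N) \sum_i E i k ^+ 2 <= n%:R.
  have : \sum_k \sum_i E i k ^+ 2 <= n%:R :> R.
    by rewrite orthonormal_rows_sum // ler_nat leq_pred.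
  by rewrite (bigID (fun k : 'I_n => (k < 2)%N)) /=; lra.
have hh : r ^+ 2 * dotv h h <= kappa ^+ 2.
  have -> : dotv h h = (n.-1%:R * enorm (mean_curvature g phi p)) ^+ 2.
    rewrite exprMn -dotvv_enorm /dotv mulr_sumr; apply: eq_bigr => k _.
    by rewrite !mxE; ring.
  have mr := mulr_gt0 m0' hr.
  rewrite -exprMn mulrA [r * _]mulrC; apply: lerXn2r; rewrite ?nnegrE //.
    by rewrite mulr_ge0 ?enorm_ge0 // ltW.
  by rewrite ler_pM2l.
have ww : dotv w w <= r ^+ 2 + e * C.
  have -> : dotv w w = Q1 (phi p) + e ^+ 2 * Q2 (phi p).
    rewrite /dotv (bigID (fun k : 'I_n => (k < 2)%N)) /= [e ^+ 2 * _]mulr_sumr.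
    congr (_ + _); apply: eq_bigr => k k2;
      by rewrite [w _ _]mxE /d ?k2 ?(negbTE k2); ring.
  have := Q1r p; have := Q2C p (pmax p0).
  by nra.
have := dotv_young w h (r ^+ 2).
have r2 : 0 < r ^+ 2 by rewrite exprn_gt0.
move: S1 S2 eD; rewrite /D.
move: (\sum_(k < n | ~~ _) _) (\sum_(k < n | _) _) hh ww.
move: (dotv h h) (dotv w w) (dotv w h) => hh2 ww2 wh s2 s1 Hh Hw S1 S2 eD Y T.
have eS2 : e * s2 <= e * n%:R by rewrite ler_pM2l.
have : r ^+ 2 * (1 - e * n%:R) <= r ^+ 2 * (- wh) by rewrite ler_pM2l //; lra.
have : r ^+ 2 * (r ^+ 2 * hh2) <= r ^+ 2 * kappa ^+ 2 by rewrite ler_pM2l.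
move: Y eD; rewrite expr2 -!mulrA; clear -Hw.
by set rr := r * r in Hw *; lra.
Qed.
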